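(* Let $G$ be a finite simple graph with girth $g \geq 5$ and minimum degree $\delta \geq 2$. Then $Z(G) \geq \delta + (\delta - 2)(g - 3)$.
   Context: Zero forcing: given a coloring of the vertices of $G$ in black and white, the color-change rule converts a white vertex $u$ to black if $u$ is the only white neighbor of some black vertex $v$ (one says $v$ forces $u$). A set $S$ of vertices is a zero forcing set if, starting with the vertices of $S$ black and all other vertices white, repeatedly applying the color-change rule until no more changes are possible eventually makes every vertex black. The zero forcing number $Z(G)$ is the minimum cardinality of a zero forcing set of $G$. The girth of $G$ is the length of a shortest cycle in $G$, and $\delta$ denotes the minimum vertex degree of $G$. *)

(* Defs.v *)
From mathcomp Require Import all_boot.

Set Implicit Arguments.
Unset Strict Implicit.
Unset Printing Implicit Defensive.

(* A finite simple graph is a symmetric irreflexive relation e on a finType. *)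

Definition neighbors (T : finType) (e : rel T) (v : T) : {set T} :=
  [set w | e v w].

(* Every degree is at most #|T|, so the default value of the minimum only
   matters when T is empty, in which case min_degree e = 0. *)
Definition min_degree (T : finType) (e : rel T) : nat :=
  \big[minn/#|T|]_(v : T) #|neighbors e v|.

(* The bound 2 < size c excludes the closed walk v, w, v along a single edge,
   which is a ucycle of size 2, as well as the empty sequence. *)
Definition graph_cycle (T : finType) (e : rel T) (c : seq T) : Prop :=
  2 < size c /\ ucycle e c.

(* No number g satisfies this when the graph is acyclic (infinite girth). *)
Definition is_girth (T : finType) (e : rel T) (g : nat) : Prop :=
  (exists2 c : seq T, graph_cycle e c & size c = g) /\
  (forall c : seq T, graph_cycle e c -> g <= size c).

(* B is the set of black vertices. *)
Definition forces (T : finType) (e : rel T) (B : {set T}) (v u : T) : bool :=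
  (v \in B) && (neighbors e v :\: B == [set u]).

Definition color_change (T : finType) (e : rel T) : rel {set T} :=
  fun B B' => [exists v, exists u, forces e B v u && (B' == u |: B)].

(* The final coloring does not depend on the order in which the forces are
   performed, so it is all black iff setT is reachable from S. *)
Definition zero_forcing_set (T : finType) (e : rel T) (S : {set T}) : bool :=
  connect (color_change e) S [set: T].

(* [set: T] is always a zero forcing set, so the minimum is attained. *)
Definition zero_forcing_number (T : finType) (e : rel T) : nat :=
  #|[arg min_(S < [set: T] | zero_forcing_set e S) #|S|]|.

(* Main.v *)
(** Key estimate: if [#|A| = k >= 3] and all cycles have length at least [k + 2],
    then the vertices outside [A] adjacent to [A] number at least
    [2 - 2 k + \sum_(a in A) deg a].  By induction on [k]: contracting an edge
    inside [A] shortens cycles by at most one, so [A] may be assumed independent,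
    and a vertex of [A] sharing at most two of its neighbors with the rest of [A]
    can be removed.  If the estimate fails when neither reduction applies, double
    counting gives a root in [A] with four outgoing two-step walks
    [root - x - a], [a] in [A].  All of them can be prolonged without backtracking,
    and short non-backtracking walks from a common vertex have distinct ends, which
    produces more than [k] vertices of [A].

    In a forcing process, the first [i] forcing vertices together with all their
    neighbors occupy at most [#|S| + i] vertices; take [i = g - 2]. *)
Require Import Defs.
From mathcomp Require Import all_boot.
From mathcomp Require Import zify.

Set Implicit Arguments.
Unset Strict Implicit.
Unset Printing Implicit Defensive.

(** * Non-backtracking walks in graphs without short cycles *)

(* [o] is the vertex visited just before [x]; taking [o = x] imposes nothing on the
   first step when [e] is irreflexive. *)
Fixpoint nonbacktracking (T : eqType) (e : rel T) (o x : T) (p : seq T) : bool :=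
  if p is y :: p' then [&& e x y, y != o & nonbacktracking e x y p'] else true.

Lemma nonbacktracking_path (T : eqType) (e : rel T) (o x : T) (p : seq T) :
  nonbacktracking e o x p -> path e x p.
Proof. by elim: p o x => //= y p IH o x /and3P[-> _ /IH]. Qed.

Lemma edge_neq (T : eqType) (e : rel T) (e_irr : irreflexive e) (x y : T) :
  e x y -> y != x.
Proof. by apply: contraTneq => ->; rewrite e_irr. Qed.

Lemma nonbacktracking_base (T : eqType) (e : rel T) (e_irr : irreflexive e)
    (o x : T) (p : seq T) :
  nonbacktracking e o x p -> nonbacktracking e x x p.
Proof.
by case: p => //= y p /and3P[exy _ ->]; rewrite exy (edge_neq e_irr exy).
Qed.

(** By induction only the start [x] could recur, and the stretch of the walk up to its return would
    be a cycle of length at most [m]. *)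
Lemma nonbacktracking_uniq (T : finType) (e : rel T) (e_irr : irreflexive e)
    (m : nat) (girth_m : forall c, graph_cycle e c -> m < size c)
    (o x : T) (p : seq T) :
  nonbacktracking e o x p -> size p <= m -> uniq (x :: p).
Proof.
elim: p o x => // y p IH o x nb_p le_m.
case/and3P: (nb_p) => exy _ nb_p'.
have /= uniq_p := IH x y nb_p' (ltnW le_m).
rewrite [uniq _]/= uniq_p andbT; apply/negP => x_in.
have ney : x != y by rewrite eq_sym (edge_neq e_irr exy).
move: x_in; rewrite inE (negPf ney) /= => x_p.
move: nb_p' uniq_p le_m; case/splitPr: x_p => p1 p2 nb_p' uniq_p le_m.
have : graph_cycle e (x :: y :: p1).
  split.
    (* [p1] is nonempty: otherwise the walk would begin [x], [y], [x]. *)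
    case: p1 nb_p' {uniq_p le_m IH nb_p} => //= /and3P[_ /eqP] //.
  apply/andP; split.
    move/nonbacktracking_path: nb_p'; rewrite cat_path /= exy rcons_path.
    by case/and3P => -> ->.
  move: uniq_p; rewrite !cons_uniq cat_uniq /= !mem_cat !inE !negb_or (negPf ney) /=.
  by case/and5P => /and3P[-> _ _] -> /andP[-> _].
move/girth_m; move: le_m; rewrite /= size_cat /=; lia.
Qed.

Lemma rev_arc (T : eqType) (e : rel T) (e_sym : symmetric e) (x z : T) (p q : seq T) :
  path e x (rcons p z) -> path e x (rcons q z) -> cycle e (x :: p ++ z :: rev q).
Proof.
move=> xpz xqz; rewrite /= -cat_rcons rcons_cat cat_path xpz last_rcons -rev_cons /=.
have := rev_path e x (rcons q z); rewrite last_rcons belast_rcons => ->.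
by rewrite (eq_path (e' := e)) // => a b; rewrite /= e_sym.
Qed.

(** Cut both paths at the first vertex of [p] lying on [q]: the two arcs from [x] meet only at their
    ends, and differing first steps prevent both from being single edges. *)
Lemma cycle_of_paths (T : finType) (e : rel T) (e_sym : symmetric e)
    (x : T) (p q : seq T) :
  path e x p -> path e x q -> uniq (x :: p) -> uniq (x :: q) ->
  head x p != head x q -> has (mem q) p ->
  exists2 c, graph_cycle e c & size c <= size p + size q.
Proof.
move=> + + + + + has_w; case: (split_find has_w) => w p1 p2 /= wq p1q.
case/splitPr: {q has_w} wq p1q => q1 q2 p1q.
rewrite -(cat_rcons w q1) !cat_path => /andP[path_p _] /andP[path_q _] uniq_p uniq_q ne_head.
exists (x :: p1 ++ w :: rev q1); last first.
  rewrite /= !size_cat /= !size_rcons size_rev; lia.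
split.
  rewrite /= size_cat /= size_rev.
  case: p1 q1 ne_head {p1q uniq_p uniq_q path_p path_q} => [|? ?] [|? ?] //=; try lia.
  by rewrite eqxx.
apply/andP; split; first exact: rev_arc.
move: uniq_p uniq_q p1q.
rewrite !cat_rcons !cons_uniq !cat_uniq /= !mem_cat !inE !mem_rev rev_uniq !negb_or.
case/and5P => /and3P[-> -> _] -> /andP[-> _] _ _.
case/and5P => /and3P[-> _ _] -> /andP[-> _] _ _.
rewrite has_rev !andbT /=; apply: contra => /hasP[a a_q a_p].
by apply/hasP; exists a => //=; rewrite mem_cat a_q.
Qed.

(** Common first steps cancel. Different first steps give a short cycle by [cycle_of_paths]; if
    exactly one walk is empty, the other is closed, against [nonbacktracking_uniq]. *)
Lemma nonbacktracking_inj (T : finType) (e : rel T)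
    (e_sym : symmetric e) (e_irr : irreflexive e)
    (m : nat) (girth_m : forall c, graph_cycle e c -> m < size c)
    (x : T) (p q : seq T) :
  nonbacktracking e x x p -> nonbacktracking e x x q -> last x p = last x q ->
  size p + size q <= m -> p = q.
Proof.
elim: p x q => [|y p IH] x [|z q] // nb_p nb_q eq_last le_m.
- have := nonbacktracking_uniq e_irr girth_m nb_q.
  move=> /(_ le_m); rewrite (lastI z q) -[last z q]/(last x (z :: q)) -eq_last /=.
  by rewrite mem_rcons inE eqxx.
- have := nonbacktracking_uniq e_irr girth_m nb_p.
  rewrite addn0 in le_m.
  move=> /(_ le_m); rewrite (lastI y p) -[last y p]/(last x (y :: p)) eq_last /=.
  by rewrite mem_rcons inE eqxx.
have [eyz|neyz] := eqVneq y z.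
  subst z; congr cons; move: nb_p nb_q => /and3P[_ _ nb_p] /and3P[_ _ nb_q].
  apply: (IH y) => //; last by move: le_m => /=; lia.
  - exact: (nonbacktracking_base e_irr nb_p).
  - exact: (nonbacktracking_base e_irr nb_q).
have uniq_p : uniq (x :: y :: p).
  by apply: (nonbacktracking_uniq e_irr girth_m nb_p); move: le_m; lia.
have uniq_q : uniq (x :: z :: q).
  by apply: (nonbacktracking_uniq e_irr girth_m nb_q); move: le_m; lia.
have has_w : has (mem (z :: q)) (y :: p).
  apply/hasP; exists (last y p); first exact: mem_last.
  by rewrite -[last y p]/(last x (y :: p)) eq_last /= mem_last.
have neh : head x (y :: p) != head x (z :: q) by [].
have [c c_cycle le_c] := cycle_of_paths e_sym (nonbacktracking_path nb_p)
  (nonbacktracking_path nb_q) uniq_p uniq_q neh has_w.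
by have := girth_m c c_cycle; lia.
Qed.

(** * Branching of two-step walks *)

(* Two steps [x - s.1 - s.2] ending in [A], for a walk arriving at [x] from [o]. *)
Definition hop (T : finType) (e : rel T) (A : {set T}) (o x : T) : pred (T * T) :=
  fun s => [&& e x s.1, s.1 != o, e s.1 s.2, s.2 != x & s.2 \in A].

(** [n] counts the applications of [nx], which picks the next hop from the previous one; the walk
    thus has [n.+1] hops before its tail [t]. *)
Fixpoint hops (T : Type) (nx : T * T -> T * T) (n : nat) (s : T * T) (t : seq T) : seq T :=
  s.1 :: s.2 :: if n is n'.+1 then hops nx n' (nx s) t else t.

Lemma size_hops (T : Type) (nx : T * T -> T * T) (n : nat) (s : T * T) (t : seq T) :
  size (hops nx n s t) = n.*2.+2 + size t.
Proof. by elim: n s => //= n IH s; rewrite IH. Qed.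

Lemma last_hops (T : Type) (nx : T * T -> T * T) (n : nat) (x : T) (s : T * T) (t : seq T) :
  last x (hops nx n s t) = last (iter n nx s).2 t.
Proof. by elim: n s x => //= n IH s x; rewrite IH -iterSr. Qed.

Lemma nonbacktracking_hops (T : finType) (e : rel T) (A : {set T}) (nx : T * T -> T * T)
    (nx_hop : forall s, s.2 \in A -> hop e A s.1 s.2 (nx s))
    (n : nat) (o x : T) (s : T * T) (t : seq T) :
  hop e A o x s ->
  nonbacktracking e (iter n nx s).1 (iter n nx s).2 t ->
  nonbacktracking e o x (hops nx n s t).
Proof.
elim: n o x s => [|n IH] o x s /and5P[e1 ne1 e2 ne2 s_A] nb_t /=; rewrite e1 ne1 e2 ne2 //=.
by apply: IH; rewrite -?iterSr //; apply: nx_hop.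
Qed.

(* With [q = (#|A| + 1) %/ 4], four branches of [q] hops each and the root give
   [4 q + 1] vertices of [A], and prolonging one branch in two ways gives
   [4 q + 3]: one of these exceeds [#|A|]. *)
Lemma branching_card (T : finType) (e : rel T)
    (e_sym : symmetric e) (e_irr : irreflexive e) (A : {set T})
    (A_gt2 : 2 < #|A|) (girth_A : forall c, graph_cycle e c -> #|A|.+1 < size c)
    (A_hop : forall o x, x \in A ->
       exists s s', [/\ hop e A o x s, hop e A o x s' & s.1 != s'.1])
    (r : T) (r_A : r \in A) :
  #|[set s | hop e A r r s]| <= 3.
Proof.
set V := [set s | _]; rewrite leqNgt; apply/negP => V_gt3.
have nb_inj := nonbacktracking_inj e_sym e_irr girth_A.
(* The default [s] is never returned when [s.2] is in [A], as [A_hop] then supplies a hop. *)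
pose nx s := odflt s [pick s' | hop e A s.1 s.2 s'].
have nx_hop s : s.2 \in A -> hop e A s.1 s.2 (nx s).
  move=> s_A; rewrite /nx; case: pickP => [//|no_hop].
  by have [s1 [_ [s1_hop _ _]]] := A_hop s.1 s.2 s_A; rewrite no_hop in s1_hop.
have iter_A n s : s \in V -> (iter n nx s).2 \in A.
  rewrite inE => /and5P[_ _ _ _ s_A]; elim: n => //= n IH.
  by case/and5P: (nx_hop _ IH).
pose q := (#|A|.+1) %/ 4.
have q_gt0 : 0 < q by rewrite /q; lia.
have q4_le : 4 * q <= #|A|.+1 by rewrite /q; lia.
have q4_gt : #|A|.+1 < 4 * q + 4 by rewrite /q; lia.
case: q q_gt0 q4_le q4_gt => // q _ q4_le q4_gt.
have nb_hops n s t : s \in V ->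
    nonbacktracking e (iter n nx s).1 (iter n nx s).2 t ->
    nonbacktracking e r r (hops nx n s t).
  by rewrite inE; apply: nonbacktracking_hops.
pose I := [set (iter (u.2 : 'I_q.+1) nx u.1).2 | u in setX V [set: 'I_q.+1]].
have card_I : #|I| = #|V| * q.+1.
  rewrite card_in_imset ?cardsX ?cardsT ?card_ord // => -[s i] [s' j].
  rewrite !in_setX /= => /andP[s_V _] /andP[s'_V _] eq_end.
  (* Two branches have total length at most [4 * q.+1], within the range of [nb_inj]. *)
  have eq_hops : hops nx i s [::] = hops nx j s' [::].
    apply: (nb_inj r); rewrite ?nb_hops ?last_hops ?size_hops //=.
    by have := ltn_ord i; have := ltn_ord j; lia.
  have eq_ij : i = j.
    by apply/val_inj; have := congr1 size eq_hops; rewrite !size_hops /=; lia.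
  case: s s' eq_hops {s_V s'_V eq_end} => [x a] [x' a'].
  by rewrite eq_ij; case: (val j) => [|n] [-> ->].
have r_notin_I : r \notin I.
  apply/imsetP => -[[s i]]; rewrite in_setX => /andP[s_V _] eq_r.
  suff: hops nx i s [::] = [::] by case: (val i).
  apply: (nb_inj r); rewrite ?nb_hops ?last_hops ?size_hops //=.
  by have := ltn_ord i; lia.
have I_sub : r |: I \subset A.
  apply/subsetP => x /setU1P[-> //|/imsetP[[s i]]].
  by rewrite in_setX => /andP[s_V _] ->; apply: iter_A.
have card_rI : #|r |: I| = (#|V| * q.+1).+1 by rewrite cardsU1 r_notin_I card_I.
have := subset_leq_card I_sub; rewrite card_rI => le_A.
(* The count of ends improves the bound on [4 * q.+1] by two, just the room needed to compare a
   branch prolonged by one hop with the others. *)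
have q4_lt : 4 * q.+1 + 2 <= #|A|.+1.
  have : 4 * q.+1 <= #|V| * q.+1 by rewrite leq_mul2r V_gt3 orbT.
  by lia.
have [s0 s0_V] : exists s, s \in V by apply/set0Pn; rewrite -card_gt0; lia.
have end_A := iter_A q _ s0_V.
have [s [s' [s_hop s'_hop ne_s]]] := A_hop (iter q nx s0).1 _ end_A.
have fresh u : hop e A (iter q nx s0).1 (iter q nx s0).2 u -> u.2 \notin r |: I.
  move=> u_hop; have nb_u : nonbacktracking e r r (hops nx q s0 [:: u.1; u.2]).
    by apply: nb_hops => //=; case/and5P: u_hop => -> -> -> ->.
  apply/setU1P => -[eq_u|/imsetP[[s1 i]]].
    suff: hops nx q s0 [:: u.1; u.2] = [::] by move/(congr1 size); rewrite size_hops.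
    apply: (nb_inj r); rewrite // ?last_hops ?size_hops //=.
    by clear -q4_lt; lia.
  rewrite in_setX => /andP[s1_V _] eq_u.
  suff: hops nx q s0 [:: u.1; u.2] = hops nx i s1 [::].
    move/(congr1 size); rewrite !size_hops /=; have := ltn_ord i.
    by clear; lia.
  apply: (nb_inj r); rewrite // ?nb_hops ?last_hops ?size_hops //=.
  by have := ltn_ord i; clear -q4_lt; lia.
(* Two-step walks with the same start and end coincide, so distinct middle vertices force distinct
   ends. *)
have ne_end : s.2 != s'.2.
  apply: contra ne_s => /eqP eq_end; apply/eqP.
  have [] // : [:: s.1; s.2] = [:: s'.1; s'.2].
  apply: (nb_inj (iter q nx s0).2) => //=.
    by case/and5P: s_hop => es _ -> -> _; rewrite es (edge_neq e_irr es).
  by case/and5P: s'_hop => es _ -> -> _; rewrite es (edge_neq e_irr es).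
have : s.2 |: (s'.2 |: (r |: I)) \subset A.
  apply/subsetP => x /setU1P[->|/setU1P[->|/(subsetP I_sub) //]].
    by case/and5P: s_hop.
  by case/and5P: s'_hop.
move/subset_leq_card.
rewrite cardsU1 cardsU1 card_rI in_setU1 (negPf ne_end) (negPf (fresh _ s_hop)) (fresh _ s'_hop) /=.
have : 4 * q.+1 <= #|V| * q.+1 by rewrite leq_mul2r V_gt3 orbT.
by move: q4_gt; clear; move: (#|V| * _) => M; lia.
Qed.

(** * Neighborhoods and double counting *)

Definition open_neighborhood (T : finType) (e : rel T) (A : {set T}) : {set T} :=
  \bigcup_(a in A) neighbors e a.

Lemma in_neighborhood (T : finType) (e : rel T) (A : {set T}) (x : T) :
  reflect (exists2 a, a \in A & e a x) (x \in open_neighborhood e A).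
Proof.
apply: (iffP bigcupP) => -[a aA]; first by rewrite inE; exists a.
by exists a; rewrite ?inE.
Qed.

(** Double counting of the edges leaving [A], with weights: [F = 1] serves for the degree sum, and
    the number of neighbors in [A] minus one for the number of hops. *)
Lemma sum_neighbors (T : finType) (e : rel T) (e_sym : symmetric e) (A : {set T})
    (F : T -> nat) :
  \sum_(a in A) \sum_(x in neighbors e a) F x = \sum_x #|neighbors e x :&: A| * F x.
Proof.
rewrite (exchange_big_dep predT) //=; apply: eq_bigr => x _.
rewrite sum_nat_cond_const; congr (_ * _).
by apply: eq_card => a; rewrite !inE e_sym andbC.
Qed.

Lemma card_hop (T : finType) (e : rel T) (e_sym : symmetric e) (e_irr : irreflexive e)
    (A : {set T}) (r : T) (r_A : r \in A) :
  #|[set s | hop e A r r s]| = \sum_(x in neighbors e r) (#|neighbors e x :&: A| - 1).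
Proof.
have card_x x : x \in neighbors e r ->
    #|neighbors e x :&: A| - 1 = \sum_(a in (neighbors e x :&: A) :\ r) 1.
  rewrite inE => erx; rewrite sum1_card (cardsD1 r (_ :&: _)).
  by rewrite !inE e_sym erx r_A addKn.
rewrite (eq_bigr _ card_x) pair_big_dep /= sum1dep_card; apply: eq_card => -[x a].
rewrite !inE /hop /=; case erx: (e r x) => //=.
by rewrite (edge_neq e_irr erx) /=; case: (e x a); case: (a == r); case: (a \in A).
Qed.

(** Let [D] be the number of neighbors of [x] in [A]. Summing [(D - 1) * (D - 2) >= 0] over the
    neighborhood [N] of [A] bounds twice the degree sum by the number of hops plus [2 * #|N|]. With
    at most three hops per root this is at most [3 * #|A| + 2 * #|N|], which suffices for
    [#|A| >= 4], and for [#|A| = 3] by parity. *)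
Lemma exists_card_hop (T : finType) (e : rel T)
    (e_sym : symmetric e) (e_irr : irreflexive e) (A : {set T}) (A_gt2 : 2 < #|A|)
    (sum_gt : #|open_neighborhood e A| + 2 * #|A| < \sum_(a in A) #|neighbors e a| + 2) :
  exists2 r, r \in A & 3 < #|[set s | hop e A r r s]|.
Proof.
apply/exists_inP; apply: contraTT sum_gt => /exists_inPn no_r.
have le_hop : \sum_(r in A) #|[set s | hop e A r r s]| <= #|A| * 3.
  by rewrite -sum_nat_const; apply: leq_sum => r r_A; rewrite leqNgt no_r.
rewrite (eq_bigr _ (@card_hop _ _ e_sym e_irr A)) sum_neighbors // in le_hop.
have sum_deg : \sum_(a in A) #|neighbors e a| = \sum_x #|neighbors e x :&: A|.
  rewrite (eq_bigr (fun a => \sum_(x in neighbors e a) 1)) ?sum_neighbors //.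
    by apply: eq_bigr => x _; rewrite muln1.
  by move=> a _; rewrite sum1_card.
have le_x : (\sum_x #|neighbors e x :&: A|) * 2 <=
    \sum_x #|neighbors e x :&: A| * (#|neighbors e x :&: A| - 1)
    + #|open_neighborhood e A| * 2.
  rewrite -(sum1_card (mem (open_neighborhood e A))) [X in _ + X * 2]big_mkcond /=.
  rewrite !big_distrl -big_split /=; apply: leq_sum => x _.
  case: (posnP #|neighbors e x :&: A|) => [-> //|].
  rewrite card_gt0 => D_gt0; have -> : x \in open_neighborhood e A.
    have /set0Pn[a] := D_gt0; rewrite !inE => /andP[exa aA].
    by apply/in_neighborhood; exists a; rewrite // e_sym.
  move: D_gt0; rewrite -card_gt0; case: #|_| => [|[|[|D]]] //= _; nia.
rewrite -sum_deg in le_x; move: le_x le_hop A_gt2; clear.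
by rewrite -leqNgt; lia.
Qed.

(** Of three neighbors shared with the rest of [A], two remain when the arrival vertex [o] is
    excluded. This gives the two prolongations required by [branching_card], whose bound contradicts
    [exists_card_hop]. *)
Lemma sum_degree_indep (T : finType) (e : rel T)
    (e_sym : symmetric e) (e_irr : irreflexive e) (A : {set T})
    (A_gt2 : 2 < #|A|) (girth_A : forall c, graph_cycle e c -> #|A|.+1 < size c)
    (deg_A : forall x, x \in A ->
       2 < #|neighbors e x :&: open_neighborhood e (A :\ x)|) :
  \sum_(a in A) #|neighbors e a| + 2 <= #|open_neighborhood e A| + 2 * #|A|.
Proof.
rewrite leqNgt; apply/negP => /(exists_card_hop e_sym e_irr A_gt2)[r r_A].
rewrite ltnNge (branching_card e_sym e_irr A_gt2 girth_A) // => o x x_A.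
have : 1 < #|(neighbors e x :&: open_neighborhood e (A :\ x)) :\ o|.
  by have := deg_A x x_A; rewrite (cardsD1 o); case: (o \in _); rewrite //= ?ltnS => /ltnW.
case/card_gt1P => y [z [+ + ne_yz]].
rewrite !in_setD1 !inE => /and3P[ne_yo exy /in_neighborhood[a /setD1P[ne_ax aA] eay]].
move=> /and3P[ne_zo exz /in_neighborhood[b /setD1P[ne_bx bA] ebz]].
exists (y, a), (z, b); split => //.
  by rewrite /hop /= exy ne_yo e_sym eay ne_ax aA.
by rewrite /hop /= exz ne_zo e_sym ebz ne_bx bA.
Qed.

(** * Short cycles and the case of three vertices *)

Lemma disjoint_neighbors_edge (T : finType) (e : rel T)
    (e_sym : symmetric e) (e_irr : irreflexive e)
    (girth_gt3 : forall c, graph_cycle e c -> 3 < size c) (x y : T) :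
  e x y -> [disjoint neighbors e x & neighbors e y].
Proof.
move=> exy; rewrite disjoint_subset; apply/subsetP => z; rewrite !inE => exz.
apply/negP => eyz; suff /girth_gt3 : graph_cycle e [:: x; y; z] by [].
split=> //; rewrite /ucycle /= exy eyz e_sym exz /= !inE negb_or.
by rewrite eq_sym (edge_neq e_irr exy) eq_sym (edge_neq e_irr exz) eq_sym (edge_neq e_irr eyz).
Qed.

Lemma card_common_neighbors (T : finType) (e : rel T)
    (e_sym : symmetric e) (e_irr : irreflexive e)
    (girth_gt4 : forall c, graph_cycle e c -> 4 < size c) (x y : T) :
  x != y -> #|neighbors e x :&: neighbors e y| <= 1.
Proof.
move=> ne_xy; rewrite leqNgt; apply/negP => /card_gt1P[z [w []]].
rewrite !inE => /andP[exz eyz] /andP[exw eyw] ne_zw.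
suff /girth_gt4 : graph_cycle e [:: x; z; y; w] by [].
split=> //; rewrite /ucycle /= exz e_sym eyz eyw e_sym exw /= !inE !negb_or.
rewrite ne_xy ne_zw eq_sym (edge_neq e_irr exz) eq_sym (edge_neq e_irr exw).
by rewrite (edge_neq e_irr eyz) eq_sym (edge_neq e_irr eyw).
Qed.

(** Inclusion-exclusion. If [t] edges lie inside [A], the pairs have at most [3 - t] common
    neighbors in total, and at most [t + 1] vertices of [A] lie in its neighborhood: a loss of at
    most 4. *)
Lemma sum_degree_card3 (T : finType) (e : rel T)
    (e_sym : symmetric e) (e_irr : irreflexive e) (A : {set T}) (card_A : #|A| = 3)
    (girth_gt4 : forall c, graph_cycle e c -> 4 < size c) :
  \sum_(a in A) #|neighbors e a| + 2 <= #|open_neighborhood e A :\: A| + 2 * #|A|.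
Proof.
have [a [b [aA bA ne_ab neab]]] : exists a b, [/\ a \in A, b \in A, a != b & ~~ e a b].
  have : 2 < #|A| by rewrite card_A.
  case/card_gt2P => a [b [c [[aA bA cA] [ne_ab ne_bc ne_ca]]]].
  case eab: (e a b); last by exists a, b; rewrite eab.
  case ebc: (e b c); last by exists b, c; rewrite ebc.
  case eca: (e c a); last by exists c, a; rewrite eca.
  suff /girth_gt4 : graph_cycle e [:: a; b; c] by [].
  by split=> //; rewrite /ucycle /= eab ebc eca !inE negb_or ne_ab ne_bc eq_sym ne_ca.
have /eqP/cards1P[c def_c] : #|A :\ a :\ b| = 1.
  have := cardsD1 a A; have := cardsD1 b (A :\ a).
  by rewrite !inE aA bA eq_sym ne_ab /= card_A; lia.
have : c \in A :\ a :\ b by rewrite def_c set11.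
rewrite !inE => /and3P[ne_cb ne_ca cA].
have def_A : A = [set a; b; c].
  apply/setP => x; have /setP/(_ x) := def_c; rewrite !inE.
  by case: eqVneq => [->|_]; case: eqVneq => [->|_]; rewrite ?aA ?bA /= ?orbT /=.
have def_N : open_neighborhood e A = neighbors e a :|: neighbors e b :|: neighbors e c.
  apply/setP => x; rewrite !inE; apply/in_neighborhood/idP.
    case=> y + eyx; rewrite def_A !inE.
    by case/orP => [/orP[]|] /eqP eq_y; rewrite -eq_y eyx ?orbT.
  by case/orP => [/orP[]|]; [exists a|exists b|exists c].
have sum_A : \sum_(x in A) #|neighbors e x| =
    #|neighbors e a| + #|neighbors e b| + #|neighbors e c|.
  by rewrite (big_setD1 a) // (big_setD1 b) /= ?def_c ?big_set1 ?addnA // !inE eq_sym ne_ab.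
have le_ab := card_common_neighbors e_sym e_irr girth_gt4 ne_ab.
have common y : y != c -> #|neighbors e y :&: neighbors e c| <= ~~ e y c.
  move=> ne_yc; case eyc: (e y c); last exact: card_common_neighbors.
  rewrite leqn0 cards_eq0 setI_eq0; apply: disjoint_neighbors_edge => // d /girth_gt4; exact: ltnW.
have le_ac : #|neighbors e a :&: neighbors e c| <= ~~ e a c by rewrite common // eq_sym.
have le_bc : #|neighbors e b :&: neighbors e c| <= ~~ e b c by rewrite common // eq_sym.
have le_A : #|A :&: open_neighborhood e A| <= e a c + e b c + (e a c || e b c).
  have sub : A :&: open_neighborhood e A \subset
      [set x in [:: a] | e a c] :|: [set x in [:: b] | e b c] :|: [set x in [:: c] | e a c || e b c].
    apply/subsetP => x; rewrite def_N def_A !inE.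
    case/andP => /orP[/orP[]|] /eqP ->.
    - rewrite e_irr (e_sym b) (negPf neab) (e_sym c a) /= => ->; by rewrite eqxx /= ?orbT.
    - rewrite e_irr (negPf neab) (e_sym c b) /= => ->; by rewrite eqxx /= ?orbT.
    - by rewrite e_irr orbF eqxx => ->; rewrite orbT.
  apply: leq_trans (subset_leq_card sub) _; rewrite !cardsU.
  have card_le1 (x : T) (P : bool) : #|[set y in [:: x] | P]| <= P.
    case: P; last by rewrite leqn0 cards_eq0; apply/eqP/setP => y; rewrite !inE andbF.
    by apply: (@leq_trans #|[set x]|); [apply/subset_leq_card/subsetP => y; rewrite !inE andbT | rewrite cards1].
  have := card_le1 a (e a c); have := card_le1 b (e b c); have := card_le1 c (e a c || e b c).
  lia.
have := cardsID A (open_neighborhood e A).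
have := cardsUI (neighbors e a) (neighbors e b).
have := cardsUI (neighbors e a :|: neighbors e b) (neighbors e c).
have : #|(neighbors e a :|: neighbors e b) :&: neighbors e c| <=
    #|neighbors e a :&: neighbors e c| + #|neighbors e b :&: neighbors e c|.
  by rewrite setIUl cardsU leq_subr.
rewrite -def_N sum_A setIC card_A.
move: le_A le_ab le_ac le_bc; clear.
by case: (e a c); case: (e b c); rewrite /= setIC; lia.
Qed.

(** * Contracting an edge *)

(* [v] becomes isolated and [u] inherits its neighbors. *)
Definition contract (T : eqType) (e : rel T) (u v : T) : rel T :=
  fun x y => [&& x != v, y != v, x != y
    & [|| e x y, (x == u) && e v y | (y == u) && e x v]].

Lemma contract_sym (T : eqType) (e : rel T) (e_sym : symmetric e) (u v : T) :
  symmetric (contract e u v).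
Proof.
move=> x y; rewrite /contract (eq_sym x y) (e_sym x y) (e_sym v y) (e_sym x v).
by case: (x == v); case: (y == v); rewrite //= [X in _ || X]orbC.
Qed.

Lemma contract_irr (T : eqType) (e : rel T) (u v : T) : irreflexive (contract e u v).
Proof. by move=> x; rewrite /contract eqxx !andbF. Qed.

(** Only a cycle through [u] can change. If both its edges at [u] come from the same end of [u - v],
    that end replaces [u]; otherwise the edge [u - v] is inserted there, which costs one more
    vertex. *)
Lemma contract_cycle (T : finType) (e : rel T) (e_sym : symmetric e) (e_irr : irreflexive e)
    (u v : T) (euv : e u v) (c : seq T) :
  graph_cycle (contract e u v) c ->
  exists2 c', graph_cycle e c' & size c' <= (size c).+1.
Proof.
case=> size_c /andP[cycle_c uniq_c].
have v_c : v \notin c.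
  by apply/negP => v_c; have := next_cycle cycle_c v_c; rewrite /contract eqxx.
have sub : {in predC1 u &, subrel (contract e u v) e}.
  by move=> x y /negPf xu /negPf yu /and4P[_ _ _]; rewrite xu yu orbF.
have [u_c|u_c] := boolP (u \in c); last first.
  exists c => //; split=> //; apply/andP; split=> //.
  apply: (sub_in_cycle sub) cycle_c.
  by apply/allP => x x_c; apply: contraNneq u_c => <-.
have [i p def_c] := rot_to u_c.
have : size (rot i c) > 2 by rewrite size_rot.
have : cycle (contract e u v) (rot i c) by rewrite rot_cycle.
have : uniq (rot i c) by rewrite rot_uniq.
have : v \notin rot i c by rewrite mem_rot.
rewrite -(size_rot i c) def_c {i c def_c size_c cycle_c uniq_c v_c u_c}.
(* [y] and [z] are the two distinct neighbors of [u] on the cycle. *)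
case: p => [|y p] //; case/lastP: p => [|p z] // v_p uniq_p.
rewrite /= rcons_path last_rcons => /and3P[euy path_p ezu] _.
have path_yz : path e y (rcons p z).
  apply: (sub_in_path sub) path_p; have /andP[u_p _] := uniq_p.
  by apply/allP => x x_p; apply: contraNneq u_p => <-.
have ends w : contract e u v u w -> exists2 t, t \in [:: u; v] & e t w.
  case/and4P=> _ _ ne_uw; rewrite eqxx [w == u]eq_sym (negPf ne_uw) orbF => /orP[euw|evw].
    by exists u; rewrite ?inE ?eqxx.
  by exists v; rewrite ?inE ?eqxx ?orbT.
have [t t_uv ety] := ends y euy.
rewrite (contract_sym e_sym) in ezu; have [s s_uv esz] := ends z ezu.
have [eq_ts|ne_ts] := eqVneq t s.
  exists (t :: y :: rcons p z) => //; split; first by rewrite /= size_rcons.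
  apply/andP; split; first by rewrite /= ety rcons_path path_yz last_rcons eq_ts e_sym.
  move: uniq_p v_p; rewrite !cons_uniq [v \in _]inE negb_or => /andP[u_p ->] /andP[_ v_p].
  by rewrite andbT; move: t_uv; rewrite !inE => /orP[] /eqP ->.
exists (t :: y :: rcons (rcons p z) s); last by rewrite /= !size_rcons.
split; first by rewrite /= size_rcons.
have ets : e s t.
  by move: t_uv s_uv ne_ts; rewrite !inE => /orP[] /eqP-> /orP[] /eqP->; rewrite ?eqxx // e_sym.
apply/andP; split.
  by rewrite /= ety 2!rcons_path path_yz !last_rcons (e_sym z) esz ets.
have not_in x : x \in [:: u; v] -> x \notin y :: rcons p z.
  move: uniq_p v_p; rewrite cons_uniq [v \in _]inE negb_or => /andP[u_p _] /andP[_ v_p].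
  by rewrite !inE => /orP[] /eqP->; rewrite -?in_cons.
rewrite -[y :: _]/(rcons (y :: rcons p z) s) cons_uniq mem_rcons in_cons negb_or ne_ts.
rewrite (not_in t) // rcons_uniq (not_in s) //.
by case/andP: uniq_p.
Qed.

(** Without triangles [u] and [v] have no common neighbor, so merging them loses only the two ends
    of [u - v], and any other neighbor of [v] just exchanges [v] for [u]. *)
Lemma sum_degree_contract (T : finType) (e : rel T)
    (e_sym : symmetric e) (e_irr : irreflexive e)
    (girth_gt3 : forall c, graph_cycle e c -> 3 < size c)
    (A : {set T}) (u v : T) (uA : u \in A) (vA : v \in A) (euv : e u v) :
  \sum_(a in A) #|neighbors e a| <=
  \sum_(a in A :\ v) #|neighbors (contract e u v) a| + 2.
Proof.
have ne_uv : u != v by rewrite eq_sym (edge_neq e_irr euv).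
have dis x y : e x y -> [disjoint neighbors e x & neighbors e y].
  exact: disjoint_neighbors_edge.
rewrite (big_setD1 v) //= (big_setD1 u) /= ?inE ?ne_uv //.
rewrite [X in _ <= X + 2](big_setD1 u) /= ?inE ?ne_uv //.
rewrite addnA [X in _ <= X]addnAC; apply: leq_add; last first.
  apply: leq_sum => a; rewrite !inE => /and3P[ne_au ne_av aA].
  have [eav|neav] := boolP (e a v).
    rewrite (cardsD1 v) inE eav (_ : true + _ = #|u |: neighbors e a :\ v|); last first.
      rewrite cardsU1 in_setD1 ne_uv (disjointFl (dis _ _ eav)) //.
      by rewrite inE e_sym.
    apply/subset_leq_card/subsetP => x; rewrite !inE /contract ne_av /=.
    case/predU1P => [->|/andP[ne_xv eax]].
      by rewrite ne_uv eqxx ne_au eav !orbT.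
    by rewrite ne_xv (eq_sym a) (edge_neq e_irr eax) eax.
  apply/subset_leq_card/subsetP => x; rewrite !inE /contract ne_av /= => eax.
  rewrite eax (eq_sym a) (edge_neq e_irr eax) !andbT.
  by apply: contraNneq neav => <-.
have sub : (neighbors e v :|: neighbors e u) :\: [set u; v] \subset neighbors (contract e u v) u.
  apply/subsetP => x; rewrite !inE /contract ne_uv eqxx negb_or (eq_sym u x).
  by case/andP => /andP[-> ->] /orP[] -> /=; rewrite ?orbT.
have := subset_leq_card sub; rewrite cardsD.
have := cardsUI (neighbors e v) (neighbors e u).
have := dis _ _ euv; rewrite -setI_eq0 setIC => /eqP->; rewrite cards0 addn0 => <-.
have : #|(neighbors e v :|: neighbors e u) :&: [set u; v]| <= 2.
  by rewrite (leq_trans (subset_leq_card (subsetIr _ _))) // cards2; case: eqP.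
lia.
Qed.

Lemma boundary_contract (T : finType) (e : rel T) (e_sym : symmetric e)
    (A : {set T}) (u v : T) (uA : u \in A) (vA : v \in A) (ne_uv : u != v) :
  open_neighborhood (contract e u v) (A :\ v) :\: (A :\ v) \subset
  open_neighborhood e A :\: A.
Proof.
apply/subsetP => x; rewrite !in_setD in_set1 negb_and negbK.
case/andP => + /in_neighborhood[a /setD1P[_ aA] /and4P[_ ne_xv _ eax]].
rewrite (negPf ne_xv) /= => xA; rewrite xA /=.
apply/in_neighborhood; case/or3P: eax => [eax|/andP[_ evx]|/andP[/eqP xu _]].
- by exists a.
- by exists v.
- by rewrite xu uA in xA.
Qed.

(** * Induction for the key estimate *)

Lemma sum_degree_le (T : finType) (e : rel T)
    (e_sym : symmetric e) (e_irr : irreflexive e) (A : {set T}) (A_gt2 : 2 < #|A|)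
    (girth_A : forall c, graph_cycle e c -> #|A|.+1 < size c) :
  \sum_(a in A) #|neighbors e a| + 2 <= #|open_neighborhood e A :\: A| + 2 * #|A|.
Proof.
(* The induction ranges over [e] too, since contraction changes the graph. *)
have [n] := ubnP #|A|; elim: n => // n IH in e e_sym e_irr A A_gt2 girth_A *.
rewrite ltnS => le_n.
have [card_A|ne3] := eqVneq #|A| 3.
  by apply: sum_degree_card3 => // c /girth_A; rewrite card_A.
(* Contraction lowers the degree sum by at most 2, which pays for the drop of [2 * #|A|], and does
   not enlarge the boundary. *)
have [|indep] := boolP [exists u in A, exists v in A, e u v].
  case/exists_inP => u uA /exists_inP[v vA euv].
  have ne_uv : u != v by rewrite eq_sym (edge_neq e_irr euv).
  have card_A := cardsD1 v A; rewrite vA /= in card_A.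
  have le_IH : \sum_(a in A :\ v) #|neighbors (contract e u v) a| + 2 <=
    #|open_neighborhood (contract e u v) (A :\ v) :\: (A :\ v)| + 2 * #|A :\ v|.
    apply: IH; [exact: contract_sym|exact: contract_irr|lia| |lia].
    by move=> c /(contract_cycle e_sym e_irr euv)[c' /girth_A]; lia.
  have le_b := subset_leq_card (boundary_contract e_sym uA vA ne_uv).
  have girth_gt3 c : graph_cycle e c -> 3 < size c by move/girth_A; lia.
  have le_s := sum_degree_contract e_sym e_irr girth_gt3 uA vA euv.
  lia.
have no_edge x y : x \in A -> y \in A -> e x y = false.
  move=> xA yA; apply: contraNF indep => exy.
  by apply/exists_inP; exists x => //; apply/exists_inP; exists y.
have boundary_indep (B : {set T}) : B \subset A ->
    open_neighborhood e B :\: B = open_neighborhood e B.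
  move=> /subsetP BA; apply/setDidPl; rewrite disjoint_subset; apply/subsetP => x.
  case/in_neighborhood => a /BA aA eax; rewrite !inE; apply: contraTN eax => /BA xA.
  by rewrite no_edge.
rewrite boundary_indep //.
(* Removing such a [v] shrinks the neighborhood by at least its degree minus 2, so the estimate for
   [A :\ v] suffices. *)
have [/exists_inP[v vA le_2]|big] :=
    boolP [exists v in A, #|neighbors e v :&: open_neighborhood e (A :\ v)| <= 2]; last first.
  apply: sum_degree_indep => // x xA; rewrite ltnNge; apply: contra big => le_2.
  by apply/exists_inP; exists x.
have card_A := cardsD1 v A; rewrite vA /= in card_A.
have le_IH : \sum_(a in A :\ v) #|neighbors e a| + 2 <=
    #|open_neighborhood e (A :\ v) :\: (A :\ v)| + 2 * #|A :\ v|.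
  by apply: IH => //; [lia| |lia] => c /girth_A; lia.
rewrite boundary_indep ?subD1set // in le_IH.
have def_N : open_neighborhood e A = neighbors e v :|: open_neighborhood e (A :\ v).
  by rewrite /open_neighborhood (big_setD1 v).
have := cardsUI (neighbors e v) (open_neighborhood e (A :\ v)).
rewrite (big_setD1 v) //= -def_N; lia.
Qed.

(** * Forcing processes *)

(** [A] collects the vertices that have performed a force, and [C] is its state after [i] forces.
    Each force adds one vertex to [A] and one black vertex. *)
Lemma color_change_expansion (T : finType) (e : rel T) (S B : {set T}) :
  connect (color_change e) S B ->
  exists A : {set T}, [/\ A :|: open_neighborhood e A \subset B, #|B| = #|S| + #|A|
    & forall i, i <= #|A| ->
      exists2 C : {set T}, #|C| = i & #|C :|: open_neighborhood e C| <= #|S| + i].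
Proof.
case/connectP => p; elim/last_ind: p B => [|p B' IH] B /=.
  move=> _ ->; have N0 : open_neighborhood e set0 = set0 by rewrite /open_neighborhood big_set0.
  exists set0; rewrite N0 setU0 sub0set cards0 addn0; split=> // i.
  by rewrite leqn0 => /eqP->; exists set0; rewrite ?N0 ?setU0 cards0.
rewrite rcons_path last_rcons => /andP[path_p step] ->.
have [A [sub_A card_B small]] := IH _ path_p erefl.
case/existsP: step => v /existsP[u /andP[/andP[vB /eqP def_u] /eqP ->]].
have /setDP[evu uB] : u \in neighbors e v :\: last S p by rewrite def_u set11.
(* A vertex that has forced has only black neighbors, whereas [u] is white. *)
have vA : v \notin A.
  apply: contraNN uB => vA; apply: (subsetP sub_A); rewrite in_setU; apply/orP; right.
  by apply/in_neighborhood; exists v; rewrite // inE in evu.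
have sub_A' : (v |: A) :|: open_neighborhood e (v |: A) \subset u |: last S p.
  have sub_v : neighbors e v \subset u |: last S p.
    apply/subsetP => x evx; rewrite in_setU1 orbC; have [//|xB] := boolP (x \in last S p).
    by rewrite -in_set1 -def_u in_setD xB.
  have sub_B : A :|: open_neighborhood e A \subset u |: last S p.
    exact: subset_trans sub_A (subsetU1 _ _).
  rewrite /open_neighborhood bigcup_setU big_set1 -/(open_neighborhood e A).
  rewrite !subUset in sub_B *; case/andP: sub_B => -> ->.
  by rewrite sub_v sub1set in_setU1 vB orbT.
have card_A' : #|u |: last S p| = #|S| + #|v |: A|.
  by rewrite !cardsU1 uB vA card_B addnCA.
exists (v |: A); split=> // i; rewrite leq_eqVlt => /predU1P[->|].
  by exists (v |: A) => //; rewrite -card_A' subset_leq_card.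
by rewrite cardsU1 vA ltnS => /small.
Qed.

Lemma zero_forcing_set_expansion (T : finType) (e : rel T) (S : {set T}) (i : nat) :
  zero_forcing_set e S -> i <= #|T| ->
  exists2 C : {set T}, #|C| = i & #|open_neighborhood e C :\: C| <= #|S|.
Proof.
case/color_change_expansion => A [_ card_T small] le_i.
suff [C card_C le_C] : exists2 C : {set T}, #|C| = i & #|C :|: open_neighborhood e C| <= #|S| + i.
  exists C => //; have := cardsUI C (open_neighborhood e C).
  by have := cardsID C (open_neighborhood e C); rewrite setIC; lia.
(* If fewer than [i] forces occur, then [#|T| <= #|S| + i] and any [i] vertices do. *)
have [/small //|lt_i] := leqP i #|A|.
have /card_geqP[s [uniq_s size_s _]] := le_i.
exists [set x in s]; first by rewrite cardsE (card_uniqP uniq_s).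
by apply: leq_trans (max_card _) _; rewrite -cardsT card_T leq_add2l ltnW.
Qed.

Lemma min_degree_le (T : finType) (e : rel T) (v : T) : min_degree e <= #|neighbors e v|.
Proof.
rewrite /min_degree; have := mem_index_enum v; elim: (index_enum T) => // w r IH.
by rewrite in_cons big_cons geq_min => /predU1P[->|/IH ->]; rewrite ?leqnn ?orbT.
Qed.

Theorem theorem1p2 (T : finType) (e : rel T)
    (e_sym : symmetric e) (e_irr : irreflexive e)
    (g : nat) (e_girth : is_girth e g) (g_ge5 : 5 <= g)
    (delta_ge2 : 2 <= min_degree e) :
  min_degree e + (min_degree e - 2) * (g - 3) <= zero_forcing_number e.
Proof.
case: e_girth => -[c [_ /andP[_ uniq_c]] size_c] girth_g.
rewrite /zero_forcing_number; case: arg_minnP => [|S S_zf _]; first exact: connect0.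
(* A shortest cycle already has [g] vertices. *)
have le_T : g - 2 <= #|T|.
  by rewrite -size_c (leq_trans (leq_subr _ _)) // -(card_uniqP uniq_c) max_card.
have [A card_A le_S] := zero_forcing_set_expansion S_zf le_T.
(* [g - 2] is the largest cardinality the girth condition permits, and it is at least 3 as
   [g >= 5]. *)
have : \sum_(a in A) #|neighbors e a| + 2 <= #|open_neighborhood e A :\: A| + 2 * #|A|.
  apply: sum_degree_le => //; first by lia.
  by move=> d /girth_g; lia.
have : #|A| * min_degree e <= \sum_(a in A) #|neighbors e a|.
  by rewrite -sum_nat_const; apply: leq_sum => a _; apply: min_degree_le.
(* What remains is the identity [(g - 2) * d + 2 - 2 * (g - 2) = d + (d - 2) * (g - 3)], with [d]
   the minimum degree. *)
rewrite card_A; move: le_S g_ge5 delta_ge2; clear.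
move: (min_degree e) => d; move: #|_| => s.
move: (\sum_(a in A) _) => t; move: #|_| => b.
case: g => [|[|[|[|[|g]]]]] // le_S _ d_ge2; rewrite !subSS !subn0.
case: d d_ge2 => [|[|d]] // _; rewrite !subSS !subn0.
nia.
Qed.
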